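(* Let $R$ be a subring of a reduced ring $T$. Then the following hold: (1) For each $x\in T$, $r.ann_R(x)=l.ann_R(x)$. In particular, $Rx$ is a simple left $R$-module if and only if $xR$ is a simple right $R$-module. (2) For each $x\in T$ and $n\geq 1$, $l.ann_R(x)=l.ann_R(x^n)$. In particular, $Rx$ is simple if and only if $Rx^n$ is simple. (3) $Soc({}_RT)=Soc(T_R)$ is an ideal of $T$. (4) If $I$ is a simple left $R$-submodule of $T$, then $I^2=I$ if and only if there exists a central idempotent $e$ of $T$ such that $I=Re$.
   Context: All rings are associative and unital (not necessarily commutative), and subrings contain the identity of the big ring; ''ideal'' means two-sided ideal. A ring is reduced if it has no nonzero nilpotent elements. $l.ann_R(x)=\{r\in R: rx=0\}$, $r.ann_R(x)=\{r\in R: xr=0\}$. $Soc({}_RT)$ (resp. $Soc(T_R)$) is the socle of $T$ as a left (resp. right) $R$-module. $I^2$ denotes the additive subgroup generated by the products $ab$ with $a,b\in I$. *)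

(* Defs.v *)
From HB Require Import structures.
From mathcomp Require Import all_boot all_algebra.
From mathcomp Require Import boolp classical_sets.

Set Implicit Arguments.
Unset Strict Implicit.
Unset Printing Implicit Defensive.

Import GRing.Theory.
Local Open Scope classical_set_scope.
Local Open Scope ring_scope.

Definition reduced_ring (T : pzRingType) : Prop :=
  forall (x : T) (n : nat), x ^+ n = 0 -> x = 0.

Section Subring.
Context {T : pzRingType}.
Implicit Types (R A B N L I : set T) (x e : T).

(* A subset of T is a classical set, and the closure predicates of the library
   apply to it through its membership predicate. *)
Definition is_subring R : Prop := subring_closed [in R].

Definition is_additive_subgroup A : Prop := zmod_closed [in A].

Definition lann R x : set T := [set r | R r /\ r * x = 0].
Definition rann R x : set T := [set r | R r /\ x * r = 0].

Definition lmul R x : set T := [set r * x | r in R].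
Definition rmul R x : set T := [set x * r | r in R].

Definition is_lsubmodule R L : Prop :=
  is_additive_subgroup L /\ forall r x, R r -> L x -> L (r * x).
Definition is_rsubmodule R L : Prop :=
  is_additive_subgroup L /\ forall r x, R r -> L x -> L (x * r).

Definition simple_lsubmodule R L : Prop :=
  [/\ is_lsubmodule R L, L <> [set 0] &
      forall N, is_lsubmodule R N -> N `<=` L -> N = [set 0] \/ N = L].
Definition simple_rsubmodule R L : Prop :=
  [/\ is_rsubmodule R L, L <> [set 0] &
      forall N, is_rsubmodule R N -> N `<=` L -> N = [set 0] \/ N = L].

(* The sum of a family of submodules is the smallest submodule containing all
   its members; in particular the empty sum is [set 0]. *)
Definition lsocle R : set T :=
  smallest (is_lsubmodule R) (\bigcup_(L in simple_lsubmodule R) L).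
Definition rsocle R : set T :=
  smallest (is_rsubmodule R) (\bigcup_(L in simple_rsubmodule R) L).

(* The two-sided ideals of T, T itself included; idealr_closed only describes
   the proper left ideals. *)
Definition is_ideal A : Prop :=
  is_additive_subgroup A /\ forall t x, A x -> A (t * x) /\ A (x * t).

Definition set_square A : set T :=
  smallest is_additive_subgroup [set a * b | a in A & b in A].

Definition central_idempotent e : Prop :=
  e * e = e /\ forall t : T, e * t = t * e.

End Subring.

(* Main.v *)
(* The crux is that whether R x is simple depends only on lann R x: it says that
   lann R x is a maximal left ideal of R.  In a reduced ring lann R x is also
   the right annihilator of x, hence a two-sided ideal M of R, and R / M is a
   division ring, so that x R is simple as well; moreover lann R x is unchanged
   when x is replaced by a power.  If R x is simple and t is in T, then
   R x t is a quotient of R x; symmetrically for t x R, so the elements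
   generating a simple submodule span an ideal of T.  Finally, idempotents of a
   reduced ring are central, and a simple I with I b <> 0 for some b in I
   contains an idempotent, obtained by solving e b = b. *)
Require Import Defs.
From mathcomp Require Import all_boot all_algebra.
From mathcomp Require Import boolp classical_sets.

Import GRing.Theory.
Local Open Scope classical_set_scope.
Local Open Scope ring_scope.

Lemma additive_subgroupP (T : pzRingType) (A : set T) :
  is_additive_subgroup A <->
  A 0 /\ (forall x y, A x -> A y -> A (x - y)).
Proof.
split=> -[A0 AB]; split.
- by apply: set_mem.
- by move=> x y Ax Ay; apply/set_mem/AB; apply: mem_set.
- by apply: mem_set.
- by move=> x y /set_mem Ax /set_mem Ay; apply/mem_set/AB.
Qed.

Lemma subringP (T : pzRingType) (R : set T) :
  is_subring R <->
  [/\ R 1, (forall x y, R x -> R y -> R (x - y)) &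
      forall x y, R x -> R y -> R (x * y)].
Proof.
split=> -[R1 RB RM]; split.
- by apply: set_mem.
- by move=> x y Rx Ry; apply/set_mem/RB; apply: mem_set.
- by move=> x y Rx Ry; apply/set_mem/RM; apply: mem_set.
- by apply: mem_set.
- by move=> x y /set_mem Rx /set_mem Ry; apply/mem_set/RB.
- by move=> x y /set_mem Rx /set_mem Ry; apply/mem_set/RM.
Qed.

Lemma subring_converse (T : pzRingType) (R : set T) :
  is_subring R -> is_subring (R : set T^c).
Proof.
move/subringP=> [R1 RB RM]; apply/subringP; split=> // x y Rx Ry.
exact: RM.
Qed.

(** * Additive spans *)

Section AdditiveSpan.
Context {T : pzRingType}.
Implicit Types (A G : set T).

Lemma smallest_additive_subgroup G :
  is_additive_subgroup (smallest is_additive_subgroup G).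
Proof.
apply/additive_subgroupP; split=> [A [/additive_subgroupP[A0 _] _] //|].
move=> x y Gx Gy A [sA GA]; have /additive_subgroupP[_ AB] := sA.
by apply: AB; [apply: Gx|apply: Gy].
Qed.

(** The preimage of the span under [f] is an additive subgroup, so it is enough to treat generators.
    The nonzero proviso serves [lminimal], which excludes 0 although [f] may kill some of its
    elements. *)
Lemma smallest_morph (f : T -> T) G x :
    {morph f : y z / y - z} ->
    (forall y, G y -> f y <> 0 -> G (f y)) ->
  smallest is_additive_subgroup G x ->
  smallest is_additive_subgroup G (f x).
Proof.
move=> fB Gf; set S := smallest _ G.
have /additive_subgroupP[S0 SB] : is_additive_subgroup S.
  exact: smallest_additive_subgroup.
suff: S `<=` f @^-1` S by apply.
apply: smallest_sub => [|y Gy] /=.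
  apply/additive_subgroupP; split=> [|y z /= Sy Sz]; last by rewrite fB; apply: SB.
  by rewrite /= -[X in f X](subrr 0) fB subrr.
have [->//|/eqP fy0] := eqVneq (f y) 0.
by apply: sub_gen_smallest; apply: Gf.
Qed.

End AdditiveSpan.

(** * Generators of simple submodules and the socle *)

Section Minimal.
Context {T : pzRingType}.
Implicit Types (R L : set T) (x y t : T).

(** Simplicity of [R x] in terms of its generator. It speaks of elements only, so it compares
    directly across annihilators and with the opposite ring. *)
Definition lminimal R : set T := [set x |
  x <> 0 /\ forall r, R r -> r * x <> 0 -> exists2 s, R s & s * (r * x) = x].

Lemma lmul_lsubmodule R x : is_subring R -> is_lsubmodule R (lmul R x).
Proof.
move=> /subringP[R1 RB RM]; split.
  apply/additive_subgroupP; split.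
    by exists 0; rewrite ?mul0r // -(subrr 1); apply: RB.
  move=> _ _ [r Rr <-] [s Rs <-].
  by exists (r - s); [apply: RB|rewrite mulrBl].
by move=> r _ Rr [s Rs <-]; exists (r * s); [apply: RM|rewrite mulrA].
Qed.

Lemma lmul_id R x : is_subring R -> lmul R x x.
Proof. by move=> /subringP[R1 _ _]; exists 1; rewrite ?mul1r. Qed.

Lemma simple_lsubmodule_lmul R L x : is_subring R ->
  simple_lsubmodule R L -> L x -> x <> 0 -> L = lmul R x.
Proof.
move=> hR [[_ LM] _ Lmin] Lx x0.
have sub : lmul R x `<=` L by move=> _ [r Rr <-]; apply: LM.
have [x00|//] := Lmin _ (lmul_lsubmodule _ x hR) sub.
by have := lmul_id R x hR; rewrite x00.
Qed.

Lemma simple_lmulP R x : is_subring R ->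
  simple_lsubmodule R (lmul R x) <-> lminimal R x.
Proof.
move=> hR; split=> [simx|[x0 xmin]].
  split=> [x0|r Rr rx0].
    have [_ + _] := simx; apply; apply/seteqP; split=> y.
      by move=> [r _ <-] /=; rewrite x0 mulr0.
    by move=> /= ->; rewrite -x0; apply: lmul_id.
  have := lmul_id R x hR.
  rewrite (simple_lsubmodule_lmul _ _ _ hR simx _ rx0); last by exists r.
  by case=> s Rs sE; exists s.
split; first exact: lmul_lsubmodule.
  by move=> xR0; have := lmul_id R x hR; rewrite xR0.
move=> N [/additive_subgroupP[N0 _] NM] Nx.
have [[y Ny y0]|nN] := pselect (exists2 y, N y & y <> 0); [right|left].
  apply/seteqP; split=> // _ [r Rr <-]; apply: (NM) => //.
  have [q Rq qE] := Nx y Ny.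
  (* The nonzero [y = q * x] of [N] is carried back to [x] by some [s], so [x] lies in [N]. *)
  by have [s Rs <-] := xmin q Rq ltac:(by rewrite qE); apply: NM; rewrite ?qE.
apply/seteqP; split=> [y Ny|y -> //] /=.
by apply: contrapT => y0; apply: nN; exists y.
Qed.

Lemma simple_lsubmodule_lminimal R L x : is_subring R ->
  simple_lsubmodule R L -> L x -> x <> 0 -> lminimal R x.
Proof.
move=> hR simL Lx x0; apply/(simple_lmulP _ _ hR).
by rewrite -(simple_lsubmodule_lmul _ _ _ hR simL Lx x0).
Qed.

Lemma lminimal_mulr R x t : lminimal R x -> x * t <> 0 -> lminimal R (x * t).
Proof.
move=> [_ xmin] xt0; split=> // r Rr rxt0.
have [|s Rs sE] := xmin r Rr.
  by move=> rx0; apply: rxt0; rewrite mulrA rx0 mul0r.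
by exists s; rewrite // mulrA mulrA -(mulrA s) sE.
Qed.

Lemma lminimal_scale R r x : is_subring R -> R r ->
  lminimal R x -> r * x <> 0 -> lminimal R (r * x).
Proof.
move=> /subringP[_ _ RM] Rr [_ xmin] rx0; split=> // q Rq qrx0.
have [||s Rs sE] := xmin (q * r); [exact: RM|by rewrite -mulrA|].
by exists (r * s); [exact: RM|rewrite -mulrA (mulrA q) sE].
Qed.

(** The equation [s * (r * x) = x] says that [s * r - 1] annihilates [x], so minimality can be read
    off the annihilator. *)
Lemma lminimal_lann R x y : is_subring R -> lann R x = lann R y ->
  lminimal R x -> lminimal R y.
Proof.
move=> /subringP[R1 RB RM] annE [x0 xmin].
have ann r : R r -> r * x = 0 <-> r * y = 0.
  move=> Rr; have : lann R x r <-> lann R y r by rewrite annE.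
  by rewrite /lann /=; tauto.
split=> [y0|r Rr ry0].
  by apply: x0; rewrite -[x]mul1r; apply/ann; rewrite ?mul1r.
have [|s Rs sE] := xmin r Rr; first by move=> /(ann r Rr).
exists s => //; apply/eqP; rewrite -subr_eq0 mulrA -[X in _ - X]mul1r -mulrBl.
apply/eqP/ann; first by apply: RB => //; apply: RM.
by rewrite mulrBl mul1r -mulrA sE subrr.
Qed.

(** Scaling by [R] sends a minimal element to 0 or to a minimal element, so the additive span is
    already a left submodule. *)
Lemma lsocleE R : is_subring R ->
  lsocle R = smallest is_additive_subgroup (lminimal R).
Proof.
move=> hR; apply/seteqP; split.
  apply: smallest_sub; last first.
    move=> x [L simL Lx].
    have [->|/eqP x0] := eqVneq x 0.
      by have /additive_subgroupP[] := smallest_additive_subgroup (lminimal R).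
    by apply: sub_gen_smallest; apply: simple_lsubmodule_lminimal simL Lx x0.
  split; first exact: smallest_additive_subgroup.
  move=> r x Rr Sx; apply: (smallest_morph ( *%R r)) Sx => [y z|y].
    exact: mulrBr.
  exact: lminimal_scale.
move=> x Sx A [[sA _] simA]; apply: Sx; split=> // y ymin; apply: simA.
by exists (lmul R y); [apply/simple_lmulP|apply: lmul_id].
Qed.

End Minimal.

Lemma rsocleE (T : pzRingType) (R : set T) : is_subring R ->
  rsocle R = smallest is_additive_subgroup (@lminimal T^c R).
Proof. by move=> /subring_converse; apply: (@lsocleE T^c). Qed.

(** * Annihilators and idempotents in a reduced ring *)

Section Reduced.
Context {T : pzRingType}.
Hypothesis hT : reduced_ring T.
Implicit Types (a b x y e : T) (R I : set T).

Lemma reduced_sqr a : a * a = 0 -> a = 0.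
Proof. by rewrite -expr2; apply: hT. Qed.

Lemma reduced_mulC a b : a * b = 0 -> b * a = 0.
Proof.
by move=> ab0; apply: reduced_sqr; rewrite mulrA -(mulrA b) ab0 mulr0 mul0r.
Qed.

(** The square of [a * x * b] contains the factor [b * a], which is 0. *)
Lemma reduced_insert a b x : a * b = 0 -> a * x * b = 0.
Proof.
move=> /reduced_mulC ba0; apply: reduced_sqr.
by rewrite mulrA -!(mulrA _ b) mulrA -(mulrA (a * x)) (mulrA b) ba0 mul0r !(mulr0, mul0r).
Qed.

Lemma reduced_idem_central e : e * e = e -> central_idempotent e.
Proof.
move=> ee; split=> // t.
have e1 : e * (1 - e) = 0 by rewrite mulrBr mulr1 ee subrr.
have /eqP := reduced_insert _ _ t e1.
(* Inserting [t] between [e] and [1 - e], in both orders, gives [e * t = e * t * e = t * e]. *)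
rewrite mulrBr mulr1 subr_eq0 => /eqP ->.
have /eqP := reduced_insert _ _ t (reduced_mulC _ _ e1).
by rewrite mulrBl mul1r mulrBl subr_eq0 => /eqP ->.
Qed.

Lemma rann_lann R x : rann R x = lann R x.
Proof.
by apply/seteqP; split=> r [Rr r0]; split=> //; apply: reduced_mulC.
Qed.

Lemma lann_exp R x n : (1 <= n)%N -> lann R x = lann R (x ^+ n).
Proof.
case: n => // n _; apply/seteqP; split=> r [Rr r0]; split=> //.
  by rewrite exprS mulrA r0 mul0r.
(* One power of [x] is removed at a time: [r * x ^+ n.+1] squares to 0, by inserting [r * x ^+ n]
   before the last [x] of [r * x ^+ n.+2 = 0]. *)
elim: n r0 => // n IHn r0; apply: IHn; apply: reduced_sqr.
rewrite {2}exprSr !mulrA.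
have : r * x ^+ n.+1 * x = 0 by rewrite -mulrA -exprSr.
by move/(reduced_insert _ _ (r * x ^+ n)); rewrite !mulrA.
Qed.

(* Modulo the annihilator M of x every r outside M has a left inverse s; s is
   again outside M, and its left inverse t satisfies t = t s r = r. *)
Lemma lminimal_converse R x : is_subring R ->
  lminimal R x -> @lminimal T^c R x.
Proof.
move=> hR [x0 xmin]; have /subringP[R1 RB RM] := hR.
split=> // r Rr; rewrite [r * _]/(x * r : T) => xr0.
have [|s Rs sE] := xmin r Rr; first by move=> /reduced_mulC.
have [|t Rt tE] := xmin s Rs.
  move=> sx0; apply: x0; rewrite -sE mulrA; exact: reduced_insert.
exists s => //; change (x * r * s = x :> T).
have sr1 : x * (s * r - 1) = 0.
  by apply: reduced_mulC; rewrite mulrBl mul1r -mulrA sE subrr.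
have ts1 : x * (t * s - 1) = 0.
  by apply: reduced_mulC; rewrite mulrBl mul1r -mulrA tE subrr.
have tr : x * (t - r) = 0.
  have -> : t - r = (t * s - 1) * r - t * (s * r - 1).
    by rewrite mulrBl mulrBr mul1r mulr1 mulrA opprB [RHS]addrC
               addrA addrNK.
  by rewrite mulrBr mulrA ts1 mul0r mulrA (reduced_insert _ _ _ sr1) subr0.
have : x * (t - r) * s = 0 by rewrite tr mul0r.
move/eqP; rewrite mulrBr mulrBl subr_eq0 => /eqP <-.
by move/eqP: ts1; rewrite mulrBr mulr1 subr_eq0 mulrA => /eqP.
Qed.

Lemma simple_lsubmodule_squareP R I : is_subring R -> simple_lsubmodule R I ->
  set_square I = I <-> exists e, central_idempotent e /\ I = lmul R e.
Proof.
move=> hR simI; have [[sI IM] In0 Imin] := simI.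
have /additive_subgroupP[I0 IB] := sI.
split=> [II|[e [[ee eC] IE]]]; last first.
  apply/seteqP; split.
    apply: smallest_sub => // _ [a Ia [b Ib <-]]; move: Ia Ib; rewrite IE.
    have /subringP[_ _ RM] := hR.
    move=> [r Rr <-] [s Rs <-]; exists (r * s); first exact: RM.
    by rewrite -!mulrA eC -mulrA ee.
  move=> a Ia; apply: sub_gen_smallest; exists a => //.
  exists e; first by rewrite IE; apply: lmul_id.
  by move: Ia; rewrite IE => -[r _ <-]; rewrite -mulrA ee.
have Imul a b : I a -> I b -> I (a * b).
  by move=> Ia Ib; rewrite -II; apply: sub_gen_smallest; exists a => //; exists b.
have [a Ia [b Ib ab0]] : exists2 a, I a & exists2 b, I b & a * b <> 0.
  apply: contrapT => nab; apply: In0; apply/seteqP; split=> [|_ -> //].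
  rewrite -{1}II; apply: smallest_sub.
    by apply/additive_subgroupP; split=> // x y -> ->; rewrite /= subrr.
  move=> _ [a Ia [b Ib <-]] /=; apply: contrapT => ab0.
  by apply: nab; exists a => //; exists b.
(* Since [a * b] generates [I], [b = r * (a * b)] for some [r]; take [e = r * a]. *)
have [e Ie eb] : exists2 e, I e & e * b = b.
  have := Ib.
  rewrite {1}(simple_lsubmodule_lmul _ _ _ hR simI (Imul _ _ Ia Ib) ab0).
  by case=> r Rr rE; exists (r * a); [exact: IM|rewrite -mulrA].
have b0 : b <> 0 by move=> b0; apply: ab0; rewrite b0 mulr0.
have e0 : e <> 0 by move=> e0; apply: b0; rewrite -eb e0 mul0r.
(* Otherwise [d = e * e - e] generates [I], so [a] is a multiple of [d]; but [d * b = 0],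
   contradicting [a * b <> 0]. *)
have ee : e * e = e.
  apply/eqP; rewrite -subr_eq0; apply/eqP; apply: contrapT => d0.
  have Id : I (e * e - e) by apply: IB => //; apply: Imul.
  have := Ia; rewrite (simple_lsubmodule_lmul _ _ _ hR simI Id d0).
  case=> r _ aE; apply: ab0.
  by rewrite -aE -mulrA mulrBl -mulrA eb eb subrr mulr0.
exists e; split; first exact: reduced_idem_central.
exact: simple_lsubmodule_lmul simI Ie e0.
Qed.

End Reduced.

(** * Left-right symmetry and conclusion *)

Lemma reduced_converse (T : pzRingType) : reduced_ring T -> reduced_ring T^c.
Proof.
move=> hT x n xn0; apply: (hT x n); rewrite -xn0; elim: n {xn0} => // n IHn.
by rewrite exprS exprSr IHn.
Qed.

Lemma lminimal_converseE (T : pzRingType) (R : set T) :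
  reduced_ring T -> is_subring R -> @lminimal T^c R = lminimal R.
Proof.
move=> hT hR; apply/seteqP; split=> x; last exact: lminimal_converse.
move=> xmin; apply: (@lminimal_converse T^c) xmin; last exact: subring_converse.
exact: reduced_converse.
Qed.

Theorem lemma3p1 (T : pzRingType) (R : set T)
    (hT : reduced_ring T) (hR : is_subring R) :
  (* (1) *)
  ((forall x : T, rann R x = lann R x) /\
   (forall x : T,
      simple_lsubmodule R (lmul R x) <-> simple_rsubmodule R (rmul R x))) /\
  (* (2) *)
  ((forall (x : T) (n : nat), (1 <= n)%N -> lann R x = lann R (x ^+ n)) /\
   (forall (x : T) (n : nat), (1 <= n)%N ->
      (simple_lsubmodule R (lmul R x) <->
       simple_lsubmodule R (lmul R (x ^+ n))))) /\
  (* (3) *)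
  (lsocle R = rsocle R /\ is_ideal (lsocle R)) /\
  (* (4) *)
  (forall I : set T, simple_lsubmodule R I ->
     (set_square I = I <->
      exists e : T, central_idempotent e /\ I = lmul R e)).
Proof.
have convE := lminimal_converseE _ _ hT hR.
split; [split; first exact: rann_lann|split; [split; first exact: lann_exp|
  split; [split|]]].
- move=> x; apply: (iff_trans (simple_lmulP _ x hR)); rewrite -convE.
  exact: iff_sym (@simple_lmulP T^c R x (subring_converse _ _ hR)).
- move=> x n n1; have annE := lann_exp hT R x n n1.
  by rewrite !simple_lmulP //; split; apply: lminimal_lann.
- by rewrite lsocleE // rsocleE // convE.
- rewrite lsocleE //; split; first exact: smallest_additive_subgroup.
  move=> t x Sx; split.
    apply: (smallest_morph ( *%R t)) Sx => [y z|y ymin]; first exact: mulrBr.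
    (* Left multiplication by [t] is right multiplication in [T^c], where the minimal elements are
       the same. *)
    by rewrite -convE; apply: (@lminimal_mulr T^c); rewrite convE.
  apply: (smallest_morph ( *%R^~ t)) Sx => [y z|y]; first exact: mulrBl.
  exact: lminimal_mulr.
- by move=> I; apply: simple_lsubmodule_squareP.
Qed.
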